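(* Let $s\ge2$ and $1\le d\le s$ be integers. The dual code of $C_d^{\mathbb{P}}$ is the code $C_{\mathcal{U}}$ with respect to the Euclidean scalar product, i.e. $(C_d^{\mathbb{P}})^{\perp}=C_{\mathcal{U}}$.
   Context: $\mathbb{F}_q$ is the finite field with $q$ elements, $q$ a power of a prime. Let $\Delta=\{(a_1,\dots,a_s): a_i\in\{0,1\},\ \sum_{i=1}^s a_i=d\}$ and $\mathcal{H}_1=\{(a_2,\dots,a_s): (a_1,a_2,\dots,a_s)\in\Delta\}$. For $c=(c_2,\dots,c_s)\in\{0,1,\dots,q-2\}^{s-1}$ define $\widehat c=(\widehat{c_2},\dots,\widehat{c_s})\in\{0,1,\dots,q-2\}^{s-1}$ by $\widehat{c_i}=0$ if $c_i=0$ and $\widehat{c_i}=q-1-c_i$ if $c_i\neq0$. Put $\mathcal{H}_2=\{\widehat b: b\in\mathcal{H}_1\}$ and $\mathcal{U}=\{0,1,\dots,q-2\}^{s-1}\setminus\mathcal{H}_2$. Let $E_{\mathcal{U}}$ be the $\mathbb{F}_q$-span of the monomials $t_2^{a_2}\cdots t_s^{a_s}$ with $(a_2,\dots,a_s)\in\mathcal{U}$. Let $T'=(\mathbb{F}_q^* )^{s-1}=\{R_1,\dots,R_{\bar m}\}$, $\bar m=(q-1)^{s-1}$, with coordinates $t_2,\dots,t_s$, and let $Q_i=(1,R_i)$, so that $\{Q_1,\dots,Q_{\bar m}\}=\{1\}\times(\mathbb{F}_q^* )^{s-1}$ represents the projective torus in $\mathbb{P}^{s-1}$. For a polynomial $f$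 in $t_2,\dots,t_s$ put $ev_{T'}(f)=(f(R_1),\dots,f(R_{\bar m}))$, and $C_{\mathcal{U}}=ev_{T'}(E_{\mathcal{U}})\subseteq\mathbb{F}_q^{\bar m}$. The projective toric code (of degree $d$ over the $d$-th hypersimplex) is $C_d^{\mathbb{P}}=\{(f(Q_1),\dots,f(Q_{\bar m})): f\in KV_d\}$, where $KV_d$ is the $\mathbb{F}_q$-span of the monomials $t_1^{a_1}\cdots t_s^{a_s}$ with $(a_1,\dots,a_s)\in\Delta$. *)

(* Defs.v *)
From HB Require Import structures.
From mathcomp Require Import all_boot all_order all_algebra.
From mathcomp Require Import classical_sets functions.
From mathcomp Require Import mpoly.

Set Implicit Arguments.
Unset Strict Implicit.
Unset Printing Implicit Defensive.

Import GRing.Theory.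

Local Open Scope classical_set_scope.
Local Open Scope ring_scope.

(* With [s = n.+1], the variables t_1, ..., t_s are indexed by ['I_n.+1] (t_1 is
   [ord0]) and t_2, ..., t_s by ['I_n], the embedding being [lift ord0]. *)

Section Exponents.
Variables (q n d : nat).

Definition hypersimplex : set 'X_{1..n.+1} :=
  [set a | (forall i, a i = 0%N \/ a i = 1%N) /\ (\sum_(i < n.+1) a i = d)%N].

Definition mnm_tail (a : 'X_{1..n.+1}) : 'X_{1..n} :=
  [multinom a (lift ord0 i) | i < n].

Definition exp_H1 : set 'X_{1..n} := mnm_tail @` hypersimplex.

(* For q = 2 the entries of [exp_H1] may exceed q - 2 = 0; the same formula
   still applies and sends both 0 and 1 to 0. *)
Definition exp_hat (c : 'X_{1..n}) : 'X_{1..n} :=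
  [multinom (if c i == 0%N then 0%N else (q - 1 - c i)%N) | i < n].

Definition exp_H2 : set 'X_{1..n} := exp_hat @` exp_H1.

Definition exp_cube : set 'X_{1..n} :=
  [set c | forall i, (c i <= q - 2)%N].

Definition exp_U : set 'X_{1..n} := exp_cube `\` exp_H2.

End Exponents.

Section Codes.
Variable F : finFieldType.

Definition monomial_span k (A : set 'X_{1..k}) : set {mpoly F[k]} :=
  [set f | exists (ms : seq 'X_{1..k}) (c : 'X_{1..k} -> F),
     (forall m, m \in ms -> A m) /\ f = \sum_(m <- ms) c m *: 'X_[m]].

Definition ev k N (P : 'I_N -> {ffun 'I_k -> F}) (f : {mpoly F[k]}) : 'rV[F]_N :=
  \row_(i < N) f.@[P i].

Definition torus n : set {ffun 'I_n -> F} := [set x | forall j, x j != 0].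

Definition cons1 n (x : {ffun 'I_n -> F}) : {ffun 'I_n.+1 -> F} :=
  [ffun j => oapp x 1 (unlift ord0 j)].

Definition projective_toric_code n N (R : 'I_N -> {ffun 'I_n -> F}) (d : nat) :
    set 'rV[F]_N :=
  ev (fun i => cons1 (R i)) @` monomial_span (@hypersimplex n d).

Definition code_U n N (R : 'I_N -> {ffun 'I_n -> F}) (d : nat) : set 'rV[F]_N :=
  ev R @` monomial_span (@exp_U #|F| n d).

Definition dual_code N (C : set 'rV[F]_N) : set 'rV[F]_N :=
  [set w | forall c, C c -> \sum_(i < N) w 0 i * c 0 i = 0].

End Codes.

Arguments torus F n : clear implicits.

(* Main.v *)
(** On [F^*], [- \sum_(k < q - 1) z ^+ k] is 1 at [z = 1] and 0 elsewhere, so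
    multiplying over the coordinates of [x / y] gives the indicator of [x = y] on
    the torus.  Hence every word [w] is the evaluation of the polynomial supported
    on the cube whose coefficient at [a] is, up to sign, [\sum_y w y * y ^ (- a)].
    When [a = \hat b] this is the scalar product of [w] with the monomial [b],
    which vanishes for [w] in the dual code.  Conversely the scalar product of
    the monomials [a] and [b] is the sum of [x ^ (a + b)] over the torus; it
    vanishes unless [q - 1] divides every [a_i + b_i], which for [a] in the cube
    means [a = \hat b]. *)

Require Import Defs.
From mathcomp Require Import all_boot all_order all_algebra.
From mathcomp Require Import finfield.
From mathcomp Require Import classical_sets functions.
From mathcomp Require Import mpoly.
From mathcomp Require Import zify.

Set Implicit Arguments.
Unset Strict Implicit.
Unset Printing Implicit Defensive.

Import GRing.Theory.

Local Open Scope classical_set_scope.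
Local Open Scope ring_scope.

Section PowerSums.
Variable F : finFieldType.
Local Notation q := #|F|.

Lemma card_finField_gt1 : (1 < q)%N.
Proof. exact: finNzRing_gt1. Qed.

Lemma expf_card_pred (x : F) : x != 0 -> x ^+ (q - 1) = 1.
Proof.
move=> x0; apply: (mulfI x0); rewrite mulr1 -exprS.
by rewrite subn1 prednK ?expf_card // ltnW // card_finField_gt1.
Qed.

(** Otherwise all [q - 1] nonzero elements would be roots of [X^r - 1], where [r], the residue of
    [m], satisfies [0 < r < q - 1]: more roots than the degree allows. *)
Lemma exists_expf_neq1 (m : nat) :
  ~~ (q - 1 %| m)%N -> exists2 g : F, g != 0 & g ^+ m != 1.
Proof.
move=> ndvd; set r := (m %% (q - 1))%N.
have q1 := card_finField_gt1.
have r_gt0 : (0 < r)%N by rewrite lt0n.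
have r_lt : (r < q - 1)%N by rewrite ltn_mod subn_gt0.
have expr_mod (x : F) : x != 0 -> x ^+ m = x ^+ r.
  move=> x0; rewrite {1}(divn_eq m (q - 1)) exprD mulnC exprM.
  by rewrite expf_card_pred // expr1n mul1r.
case: (pickP [pred g : F | (g != 0) && (g ^+ m != 1)]) => [g /andP[]|all1].
  by exists g.
have: (size (enum (predC1 0%R : {pred F})) <= r)%N.
  apply: max_unity_roots => //; last exact: enum_uniq.
  apply/allP=> x; rewrite mem_enum inE => x0; apply/unity_rootP.
  by rewrite -expr_mod //; have /negbT := all1 x; rewrite /= x0 negbK => /eqP.
by rewrite -cardE cardC1 -subn1 leqNgt r_lt.
Qed.

(** Multiplication by [g] permutes the nonzero elements, so the sum [S] satisfies [S = g ^+ m * S]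
    with [g ^+ m != 1]. *)
Lemma sum_expf_eq0 (m : nat) :
  ~~ (q - 1 %| m)%N -> \sum_(x : F | x != 0) x ^+ m = 0.
Proof.
case/exists_expf_neq1 => g g0 gm; set S := (LHS).
have : S = g ^+ m * S.
  rewrite /S mulr_sumr (reindex_inj (mulfI g0)) /=.
  by apply: eq_big => [x|x _]; rewrite ?mulf_eq0 ?(negPf g0) ?exprMn.
move/eqP; rewrite -subr_eq0 -{1}[S]mul1r -mulrBl mulf_eq0 subr_eq0 eq_sym.
by rewrite (negPf gm) => /eqP.
Qed.

Lemma sum_torus_monomial_eq0 n (m : 'I_n -> nat) (i : 'I_n) :
  ~~ (q - 1 %| m i)%N ->
  \sum_(x : {ffun 'I_n -> F} | x \in ffun_on (predC1 0)) \prod_j x j ^+ m j = 0.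
Proof.
move=> ndvd; rewrite -(bigA_distr_big (predC1 0) (fun j x => x ^+ m j)).
by rewrite (bigD1 i) //= sum_expf_eq0 ?mul0r.
Qed.

Lemma opp_geometric_sum (z : F) :
  z != 0 -> \sum_(k < q - 1) - z ^+ k = (z == 1)%:R.
Proof.
move=> z0; rewrite sumrN; have [->|z1] := eqVneq z 1.
  rewrite (eq_bigr (fun=> 1)) => [|i _]; last by rewrite expr1n.
  rewrite sumr_const card_ord natrB 1?ltnW ?card_finField_gt1 //.
  suff -> : q%:R = 0 :> F by rewrite sub0r opprK.
  (* Translation by 1 permutes [F]; comparing both sums leaves [q%:R = 0]. *)
  have : \sum_(x : F) x = \sum_(x : F) (x + 1).
    exact: (reindex_inj (addIr (1 : F))).
  by rewrite big_split /= sumr_const -[LHS]addr0 => /addrI <-.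
have /eqP := subrX1 z (q - 1); rewrite expf_card_pred // subrr eq_sym.
by rewrite mulf_eq0 subr_eq0 (negPf z1) => /eqP ->; rewrite oppr0.
Qed.

Lemma torus_delta n (x y : {ffun 'I_n -> F}) :
    torus F n x -> torus F n y ->
  \sum_(a : {ffun 'I_n -> 'I_(q - 1)})
     (\prod_j - y j ^- a j) * \prod_j x j ^+ a j = (x == y)%:R.
Proof.
move=> Tx Ty.
under eq_bigr => a _.
  rewrite -big_split /=.
  under eq_bigr => j _ do rewrite mulNr mulrC -exprVn -exprMn.
  over.
(* With one sign per coordinate, the sum over exponent vectors factors into geometric sums in
   [x j / y j]. *)
rewrite -(bigA_distr_bigA (fun j (k : 'I_(q - 1)) => - (x j / y j) ^+ k)).
have z0 j : x j / y j != 0 by rewrite mulf_neq0 ?invr_eq0 ?Tx ?Ty.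
under eq_bigr => j _ do rewrite opp_geometric_sum //.
have [->|neq] := eqVneq x y.
  by rewrite big1 // => j _; rewrite divff ?eqxx ?Ty.
have [j xyj] : exists j, x j != y j.
  apply/existsP; apply: contraNT neq; rewrite negb_exists => /forallP eq_xy.
  by apply/eqP/ffunP => j; apply/eqP; rewrite -[_ == _]negbK.
rewrite (bigD1 j) //= -(inj_eq (mulIf (Ty j))) mul1r mulfVK ?Ty //.
by rewrite (negPf xyj) mul0r.
Qed.

End PowerSums.

Lemma exp_H1_le1 {n d} {b : 'X_{1..n}} : exp_H1 d b -> forall i, (b i <= 1)%N.
Proof.
by move=> [a [a01 _] <-] i; rewrite mnmE; case: (a01 (lift ord0 i)) => ->.
Qed.

(** The bounds give [a i + b i <= q - 1], so this multiple of [q - 1] is 0 or [q - 1]; as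
    [a i <= q - 2], the value of [b i] decides which. *)
Lemma eq_exp_hat q n (a b : 'X_{1..n}) :
    (1 < q)%N -> exp_cube q a -> (forall i, (b i <= 1)%N) ->
  (forall i, (q - 1 %| a i + b i)%N) -> a = exp_hat q b.
Proof.
move=> q1 cube_a b1 dvd; apply/mnmP=> i; rewrite mnmE.
have := cube_a i; have := b1 i; have /dvdnP[k] := dvd i.
case: eqP => [->|b0] Ek b_le a_le; case: k Ek => [|[|k]] Ek; nia.
Qed.

Section Evaluation.
Variable F : finFieldType.
Local Notation q := #|F|.

(** The hat is negation modulo [q - 1], the exponent of the group of nonzero elements. *)
Lemma expfV_hat (x : F) n (b : 'X_{1..n}) (i : 'I_n) :
  x != 0 -> (b i <= 1)%N -> x ^- exp_hat q b i = x ^+ b i.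
Proof.
move=> x0 b1; rewrite mnmE; case: eqP => [->|_]; first by rewrite expr0 invr1.
have bq : (b i <= q - 1)%N by have := card_finField_gt1 F; lia.
apply: (mulIf (expf_neq0 (q - 1 - b i) x0)).
by rewrite mulVf ?expf_neq0 // -exprD subnKC // expf_card_pred.
Qed.

Lemma meval_cons1 n (a : 'X_{1..n.+1}) (x : {ffun 'I_n -> F}) :
  'X_[a].@[cons1 x] = \prod_j x j ^+ mnm_tail a j.
Proof.
rewrite mevalX big_ord_recl ffunE unlift_none expr1n mul1r.
by apply: eq_bigr => j _; rewrite ffunE liftK mnmE.
Qed.

Lemma monomial_spanX k (A : set 'X_{1..k}) m :
  A m -> monomial_span (F := F) A 'X_[m].
Proof.
move=> Am; exists [:: m], (fun=> 1); split; last by rewrite big_seq1 scale1r.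
by move=> m'; rewrite inE => /eqP ->.
Qed.

Lemma sum_set_bij_torus n N (R : 'I_N -> {ffun 'I_n -> F})
    (hR : set_bij [set: 'I_N] (torus F n) R) (G : {ffun 'I_n -> F} -> F) :
  \sum_i G (R i) = \sum_(x | x \in ffun_on (predC1 0)) G x.
Proof.
case: hR => Rtorus Rinj Rsurj.
have injR : {in 'I_N &, injective R}.
  by move=> i j _ _; apply: Rinj; rewrite in_setE.
rewrite -(big_imset G injR) /=; apply: eq_bigl => x.
apply/imsetP/ffun_onP => [[i _ ->] j|x0].
  exact: (Rtorus i I j).
by have [i _ <-] := Rsurj x (fun j => x0 j); exists i.
Qed.

End Evaluation.

Theorem dual_projective_toric_code (F : finFieldType) n N d
    (R : 'I_N -> {ffun 'I_n -> F})
    (hR : set_bij [set: 'I_N] (torus F n) R) :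
  dual_code (projective_toric_code R d) = code_U R d.
Proof.
have q1 := card_finField_gt1 F.
have [Rtorus Rinj _] := hR.
have R0 i j : R i j != 0 by exact: (Rtorus i I j).
apply/seteqP; split=> w.
  move=> dual_w.
  pose coef (a : 'X_{1..n}) : F := \sum_i w 0 i * \prod_j - R i j ^- a j.
  have coef_hat b : exp_H1 d b -> coef (exp_hat #|F| b) = 0.
    move=> H1b; have b1 := exp_H1_le1 H1b; have [a Ha tail_a] := H1b.
    have := dual_w _ (ex_intro2 _ _ _ (monomial_spanX F Ha) erefl).
    (* The factor [(-1)^n] matches the signs built into [coef]. *)
    move/(congr1 ( *%R (\prod_(j < n) -1))); rewrite mulr0 => <-.
    rewrite mulr_sumr; apply: eq_bigr => i _.
    rewrite mulrCA mxE meval_cons1 tail_a -big_split /=.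
    by congr (_ * _); apply: eq_bigr => j _; rewrite expfV_hat // mulN1r.
  pose mon (a : {ffun 'I_n -> 'I_(#|F| - 1)}) : 'X_{1..n} :=
    [multinom (a j : nat) | j < n].
  (* Dropping zero coefficients removes every exponent of [exp_H2], by [coef_hat], without changing
     the polynomial. *)
  pose ms := [seq m <- [seq mon a | a <- enum {ffun 'I_n -> 'I_(#|F| - 1)}]
             | coef m != 0].
  exists (\sum_(m <- ms) coef m *: 'X_[m]).
    exists ms, coef; split=> // m; rewrite mem_filter => /andP[coef_m].
    case/mapP=> a _ def_m; rewrite def_m in coef_m *; split.
      by move=> j; rewrite mnmE -ltnS -subSn ?subSS ?ltn_ord.
    case=> b H1b hat_b.
    by move: coef_m; rewrite -hat_b coef_hat ?eqxx.
  apply/rowP=> i; rewrite mxE raddf_sum /= big_filter big_mkcond big_map big_enum.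
  transitivity (\sum_a coef (mon a) * \prod_j R i j ^+ a j).
    apply: eq_bigr => a _; rewrite mevalZ mevalX.
    rewrite (eq_bigr (fun j => R i j ^+ a j)) => [|j _]; last by rewrite mnmE.
    by case: eqP => // ->; rewrite mul0r.
  under eq_bigr => a _ do rewrite mulr_suml.
  (* For each point [R k], the sum over exponents is now the indicator of [R i = R k]. *)
  rewrite exchange_big /=.
  under eq_bigr => k _.
    under eq_bigr => a _.
      rewrite -mulrA (eq_bigr (fun j => - R k j ^- a j)) => [|j _]; last first.
        by rewrite mnmE.
      over.
    rewrite -mulr_sumr torus_delta; [|exact: (Rtorus i I)|exact: (Rtorus k I)].
    over.
  rewrite (bigD1 i) //= eqxx mulr1 big1 ?addr0 // => k ki.
  case: eqP => [Rik|_]; last by rewrite mulr0.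
  by case/eqP: ki; apply: Rinj; rewrite ?in_setE.
(* Converse inclusion: by bilinearity it suffices to pair single monomials [a] and [b]. *)
case=> f [ms [c [msU ->]]] <- _ [g [ms' [c' [ms'H ->]]] <-].
under eq_bigr => i _.
  rewrite !mxE !raddf_sum /= big_distrlr /=.
  over.
rewrite exchange_big big_seq big1 // => a /msU [cube_a not_hat_a].
rewrite exchange_big big_seq big1 // => b /ms'H Hb.
under eq_bigr => i _.
  rewrite /= !mevalZ meval_cons1 mevalX mulrACA -big_split /=.
  under eq_bigr => j _ do rewrite -exprD.
  over.
rewrite -mulr_sumr.
have [i ndvd] : exists i, ~~ (#|F| - 1 %| a i + mnm_tail b i)%N.
  apply/existsP; rewrite -negb_forall; apply/negP=> /forallP dvd.
  have H1b : exp_H1 d (mnm_tail b) by exists b.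
  apply: not_hat_a; exists (mnm_tail b) => //; symmetry.
  exact: eq_exp_hat (exp_H1_le1 H1b) dvd.
rewrite (sum_set_bij_torus hR
  (fun x => \prod_j x j ^+ (a j + mnm_tail b j))).
by rewrite (sum_torus_monomial_eq0 ndvd) mulr0.
Qed.

Theorem theorem5p5 (F : finFieldType) (s d : nat)
  (hs : (2 <= s)%N) (hd : (1 <= d <= s)%N)
  (R : 'I_((#|F| - 1) ^ s.-1) -> {ffun 'I_s.-1 -> F})
  (hR : set_bij [set: 'I_((#|F| - 1) ^ s.-1)] (torus F s.-1) R) :
  dual_code (projective_toric_code R d) = code_U R d.
Proof. exact: dual_projective_toric_code. Qed.
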